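(* Let $b\geq 2$ be an integer and let $\mathbf{c}=\{c_k\}_{k=0}^\infty$ be a sequence of real numbers such that $\limsup_{k\to\infty} b^k|c_k|<\infty$. Let $f_{\mathbf{c},b}(x)=\sum_{n=0}^\infty c_n\phi(b^n x)$ for $x\in[0,1]$, where $\phi(x)=\mathrm{dist}(x,\mathbb{Z})$. Then the graph $\mathcal{G}f_{\mathbf{c},b}=\{(x,f_{\mathbf{c},b}(x)):x\in[0,1]\}\subset\mathbb{R}^2$ satisfies $$\dim_A \mathcal{G}f_{\mathbf{c},b}=1.$$
   Context: $\phi(x)=\mathrm{dist}(x,\mathbb{Z})$ is the distance from the real number $x$ to the nearest integer. The hypothesis on $\mathbf{c}$ implies $\sum_{n}|c_n|<\infty$, so the series defining $f_{\mathbf{c},b}$ converges absolutely and uniformly. Assouad dimension: for a bounded set $E\subset\mathbb{R}^d$ and $\delta>0$, let $N_\delta(E)$ be the least number of open sets of diameter at most $\delta$ needed to cover $E$. Let $B(x,\rho)$ be the closed ball with center $x$ and radius $\rho$. For bounded $F\subset\mathbb{R}^d$, $\dim_A F$ is the infimum of all $\alpha>0$ for which there is a constant $C>0$ such that $N_r(B(x,R)\cap F)\leq C(R/r)^\alpha$ for all $0<r<R$ and all $x\in F$. *)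

(* Defs.v *)
From mathcomp Require Import all_boot all_order all_algebra.
From mathcomp Require Import all_classical all_reals all_analysis.

Set Implicit Arguments.
Unset Strict Implicit.
Unset Printing Implicit Defensive.

Import Order.TTheory GRing.Theory Num.Theory.
Import numFieldNormedType.Exports.

Local Open Scope classical_set_scope.
Local Open Scope ring_scope.

(* The norm that MathComp-Analysis puts on 'rV[R]_d is the max norm, so the
   Euclidean distance is spelled out; both induce the topology used by [open]. *)
Definition eucl_dist (R : realType) (d : nat) (x y : 'rV[R]_d) : R :=
  Num.sqrt (\sum_(i < d) (x ord0 i - y ord0 i) ^+ 2).

Definition eucl_closed_ball (R : realType) (d : nat) (x : 'rV[R]_d) (rho : R) :
    set 'rV[R]_d :=
  [set y | eucl_dist x y <= rho].

(* Extended-real valued: +oo on unbounded sets (and -oo on the empty set). *)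
Definition diameter (R : realType) (d : nat) (U : set 'rV[R]_d) : \bar R :=
  ereal_sup [set (eucl_dist p.1 p.2)%:E | p in U `*` U].

Definition open_coverable (R : realType) (d : nat) (delta : R)
    (E : set 'rV[R]_d) (n : nat) : Prop :=
  exists U : 'I_n -> set 'rV[R]_d,
    (forall i, open (U i) /\ (diameter (U i) <= delta%:E)%E) /\
    E `<=` \bigcup_i U i.

(* The infimum is attained as soon as some finite cover exists, which is the
   case when E is bounded and delta > 0; otherwise the value is +oo. *)
Definition covering_number (R : realType) (d : nat) (delta : R)
    (E : set 'rV[R]_d) : \bar R :=
  ereal_inf [set (n%:R : R)%:E | n in open_coverable delta E].

Definition assouad_dim (R : realType) (d : nat) (F : set 'rV[R]_d) : \bar R :=
  ereal_inf [set alpha%:E | alpha in [set alpha : R | 0 < alpha /\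
    exists2 C : R, 0 < C &
      forall (r rho : R) (x : 'rV[R]_d), 0 < r -> r < rho -> F x ->
        (covering_number r (eucl_closed_ball x rho `&` F) <=
           (C * (rho / r) `^ alpha)%:E)%E]].

Definition dist_int (R : realType) (x : R) : R :=
  inf [set `|x - m%:~R| | m in [set: int]].

Definition takagi (R : realType) (c : nat -> R) (b : nat) (x : R) : R :=
  limn (series (fun n => c n * dist_int (b%:R ^+ n * x))).

Definition graph01 (R : realType) (f : R -> R) : set 'rV[R]_2 :=
  [set \row_(i < 2) [:: x; f x]`_i | x in `[0, 1]].

(* Main.v *)
(* Let K bound b^n |c_n|. On a half b-adic interval of length b^-m / 2 the first
   m terms of the series are all affine, so f there is an affine function of
   some slope s plus a remainder. The terms of index m <= n < m + q are each
   K-Lipschitz and the later ones sum to at most 2 K b^-(m + q), hence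
     |f x - f y - s (x - y)| <= K q |x - y| + 2 K b^-(m + q)  for every q.
   The slope s is not bounded, but its effect cancels in a ball of radius
   rho ~ b^-m: the graph meets the ball above a set of diameter
   O(rho / (1 + |s|)), and with r ~ b^-(m + q) each column of width r needs
   O(|s| + q + 1) squares, and also at most O(rho / r). The total is
   O((q + 1) rho / r) with q ~ log (rho / r), which beats every exponent
   1 + e. The lower bound only uses that the graph projects onto [0, 1]. *)

Require Import Defs.
From mathcomp Require Import all_boot all_order all_algebra.
From mathcomp Require Import all_classical all_reals all_analysis.
From mathcomp Require Import zify ring lra.

Import Order.TTheory GRing.Theory Num.Theory.
Import numFieldNormedType.Exports.

Local Open Scope classical_set_scope.
Local Open Scope ring_scope.

(** * Counting covers of planar sets by slices, columns and squares *)

Section Covering.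
Context {R : realType}.
Implicit Types (E F : set 'rV[R]_2) (r w h D X Y : R) (k : 'I_2).

(** The count is bounded by a real [X], so that estimates can be added and multiplied without
    rounding. *)
Definition covers r E X : Prop :=
  exists2 n : nat, n%:R <= X & open_coverable r E n.

Lemma coversW r E F X Y : E `<=` F -> X <= Y -> covers r F X -> covers r E Y.
Proof.
move=> EF XY [n nX [U [Uo FU]]]; exists n; first exact: le_trans XY.
by exists U; split=> //; apply: subset_trans FU.
Qed.

Lemma covers_bigcup r (F : nat -> set 'rV[R]_2) m X :
  (forall i, (i < m)%N -> covers r (F i) X) ->
  covers r (\bigcup_(i in `I_m) F i) (m%:R * X).
Proof.
elim: m => [|m IH] FX.
  exists 0%N; first by rewrite mul0r.
  exists (fun=> set0); split; first by case.
  by move=> x [].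
have [n nX [U [Uo FU]]] := IH (fun i im => FX i (ltnW im)).
have [p pX [V [Vo FV]]] := FX m (ltnSn m).
exists (n + p)%N.
  by rewrite natrD -addn1 natrD mulrDl mul1r lerD.
exists (fun i => match fintype.split i with inl j => U j | inr j => V j end).
split; first by move=> i; case: fintype.splitP => j _; [exact: Uo|exact: Vo].
move=> x [i /= im Fx]; move: im; rewrite ltnS leq_eqVlt => /orP[/eqP im|im].
  have [j _ Vj] : (\bigcup_j V j) x by apply: FV; rewrite -im.
  exists (rshift n j) => //.
  by have := unsplitK (inr j : 'I_n + 'I_p); rewrite /= => ->.
have [j _ Uj] : (\bigcup_j U j) x by apply: FU; exists i.
exists (lshift p j) => //.
by have := unsplitK (inl j : 'I_n + 'I_p); rewrite /= => ->.
Qed.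

(** The slice containing [v] has index [trunc ((v_k - a) / w)], hence at most [trunc (D / w) + 1]
    slices occur. With [k = ord0] the slices are columns; with [k = ord_max] they cut a column into
    squares. *)
Lemma covers_slices r E k a D w X : 0 <= D -> 0 < w -> 0 <= X ->
  (forall v, E v -> a <= v ord0 k <= a + D) ->
  (forall t, covers r (E `&` [set v | t <= v ord0 k <= t + w]) X) ->
  covers r E ((D / w + 1) * X).
Proof.
move=> D0 w0 X0 Ea Ecov.
pose F i := E `&` [set v | a + i%:R * w <= v ord0 k <= a + i%:R * w + w].
have Dw0 : 0 <= D / w by rewrite divr_ge0// ltW.
apply: (@coversW _ _ (\bigcup_(i in `I_(Num.trunc (D / w)).+1) F i)
   ((Num.trunc (D / w)).+1%:R * X)); last first.
- by apply: covers_bigcup => i _; exact: Ecov.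
- by rewrite ler_wpM2r// -natr1 lerD2r truncn_le.
- move=> v Ev; have /andP[av vD] := Ea v Ev.
  have u0 : 0 <= (v ord0 k - a) / w by rewrite divr_ge0 ?subr_ge0 ?(ltW w0).
  exists (Num.trunc ((v ord0 k - a) / w)).
    by rewrite /= ltnS le_truncn// ler_pM2r ?invr_gt0//; lra.
  split=> //=; have /andP[] := truncn_itv u0.
  rewrite ler_pdivlMr// ltr_pdivrMr// -natr1 (mulrDl _ 1) mul1r.
  set z := _ * w; lra.
Qed.

Lemma open_box (x y h : R) :
  open [set v : 'rV[R]_2 | `|v ord0 ord0 - x| < h /\ `|v ord0 ord_max - y| < h].
Proof.
have H k z : open [set v : 'rV[R]_2 | `|v ord0 k - z| < h].
  rewrite [X in open X](_ : _ = (fun v : 'rV[R]_2 => v ord0 k) @^-1`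
      ([set t | z - h < t] `&` [set t | t < z + h])); last first.
    by apply/seteqP; split=> v /=; rewrite ltr_norml => ?; (split || apply/andP); lra.
  apply: open_comp; last exact: openI.
  by move=> v _; exact: coord_continuous.
rewrite [X in open X](_ : _ = [set v : 'rV[R]_2 | `|v ord0 ord0 - x| < h] `&`
   [set v : 'rV[R]_2 | `|v ord0 ord_max - y| < h])//.
exact: openI.
Qed.

Lemma eucl_dist2 (u v : 'rV[R]_2) : eucl_dist u v =
  Num.sqrt ((u ord0 ord0 - v ord0 ord0) ^+ 2 +
            (u ord0 ord_max - v ord0 ord_max) ^+ 2).
Proof.
rewrite /eucl_dist big_ord_recr big_ord1 /=; congr (Num.sqrt (_ ^+ 2 + _)).
by congr (_ - _); congr (fun_of_matrix _ _ _); apply: val_inj.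
Qed.

Lemma eucl_dist_coord {d : nat} (u v : 'rV[R]_d) (k' : 'I_d) :
  `|u ord0 k' - v ord0 k'| <= eucl_dist u v.
Proof.
rewrite -sqrtr_sqr /eucl_dist ler_sqrt ?sumr_ge0//; last by move=> i _; rewrite sqr_ge0.
rewrite (bigD1 k')//= lerDl sumr_ge0// => i _; exact: sqr_ge0.
Qed.

(** The corner [(x, y)] is the centre of an open box of half-side [r / 3 > r / 4]; its diagonal is
    [2 * sqrt 2 / 3 * r < r]. *)
Lemma covers_square r E x y : 0 < r ->
  (forall v, E v -> x <= v ord0 ord0 <= x + r / 4 /\
                    y <= v ord0 ord_max <= y + r / 4) ->
  covers r E 1.
Proof.
move=> r0 EB; exists 1%N => //.
exists (fun=> [set v : 'rV[R]_2 | `|v ord0 ord0 - x| < r / 3 /\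
                                  `|v ord0 ord_max - y| < r / 3]); split.
  move=> _; split; first exact: open_box.
  apply: ge_ereal_sup => _ [[u v] [[/= ux uy] [vx vy]] <-] /=.
  rewrite lee_fin eucl_dist2 -[leRHS]gtr0_norm// -(sqrtr_sqr r) ler_sqrt ?sqr_ge0//.
  move: ux uy vx vy; rewrite !ltr_norml => /andP[? ?] /andP[? ?] /andP[? ?] /andP[? ?].
  have sqB (z : R) : - (2 * r / 3) <= z <= 2 * r / 3 -> z ^+ 2 <= (2 * r / 3) ^+ 2 by nra.
  have := sqB (u ord0 ord0 - v ord0 ord0); have := sqB (u ord0 ord_max - v ord0 ord_max).
  move=> H1 H2; apply: (@le_trans _ _ ((2 * r / 3) ^+ 2 + (2 * r / 3) ^+ 2)).
    by apply: lerD; [apply: H2|apply: H1]; lra.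
  by rewrite !expr2; nra.
move=> v /EB[/andP[? ?] /andP[? ?]]; exists ord0 => //=.
by rewrite !ltr_norml; split; lra.
Qed.

Lemma covers_empty r E X : 0 <= X -> ~ (E !=set0) -> covers r E X.
Proof.
move=> X0 E0; exists 0%N => //; exists (fun=> set0); split; first by case.
by move=> x Ex; case: E0; exists x.
Qed.

Lemma covers_column r E x h : 0 < r -> 0 <= h ->
  (forall v, E v -> x <= v ord0 ord0 <= x + r / 4) ->
  (forall u v, E u -> E v -> `|u ord0 ord_max - v ord0 ord_max| <= h) ->
  covers r E (8 * h / r + 1).
Proof.
move=> r0 h0 Ex Eh; have [|nE] := pselect (E !=set0); last first.
  by apply: covers_empty => //; rewrite addr_ge0// mulr_ge0 ?invr_ge0 ?(ltW r0)//; lra.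
(* Only the oscillation [h] is known, not the lowest point, so the heights are placed in a window of
   length [2 * h] around one member. *)
move=> [v Ev]; rewrite (_ : _ + 1 = ((2 * h) / (r / 4) + 1) * 1); last by field; lra.
apply: (@covers_slices _ _ ord_max (v ord0 ord_max - h)); rewrite ?divr_gt0//.
- lra.
- move=> u Eu; have := Eh u v Eu Ev; rewrite ler_norml; lra.
- by move=> t; apply: (@covers_square r _ x t) => // u [Eu /= ut]; split; [exact: Ex|].
Qed.

(** The hypothesis at scale [rho] makes the piece narrow when [s] is large, the one at scale [r]
    bounds the height of a column; the factors [1 / (1 + |s|)] and [1 + |s|] cancel, so the bound
    does not involve [s]. *)
Lemma covers_steep r rho L K0 s (A : set R) (f : R -> R) (z : 'rV[R]_2) :
  0 < r -> r < rho -> 1 <= L -> 0 <= K0 ->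
  (forall x y, A x -> A y -> `|f x - f y - s * (x - y)| <= K0 * rho) ->
  (forall x y, A x -> A y -> `|f x - f y - s * (x - y)| <= L * `|x - y| + K0 * r) ->
  covers r ([set v : 'rV[R]_2 | A (v ord0 ord0) /\ v ord0 ord_max = f (v ord0 ord0)] `&`
            [set v : 'rV[R]_2 | `|v ord0 ord0 - z ord0 ord0| <= rho /\
                     `|v ord0 ord_max - z ord0 ord_max| <= rho])
    ((8 * (4 + K0) * (5 + 8 * K0) + 17) * L * (rho / r)).
Proof.
move=> r0 rrho L1 K00 Hrho Hr; set S := _ `&` _.
set C := _ + 17; have rho0 : 0 < rho by lra.
have C0 : 0 <= C by rewrite /C; nra.
have rr : 1 <= rho / r by rewrite ler_pdivlMr// mul1r ltW.
have s0 : 0 <= `|s| by [].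
(* Two points of [S] differ by at most [2 * rho] in each coordinate. So
   [|s| * |dx| <= (2 + K0) * rho], and adding [|dx| <= 2 * rho] gives
   [(1 + |s|) * |dx| <= (4 + K0) * rho]. *)
pose D := (4 + K0) * rho / (1 + `|s|).
have s1 : 0 < 1 + `|s| by lra.
have Ds : D * (1 + `|s|) = (4 + K0) * rho by rewrite /D divfK// lt0r_neq0.
have D0 : 0 <= D by rewrite /D divr_ge0 ?ltW//; nra.
have SD u v : S u -> S v -> `|u ord0 ord0 - v ord0 ord0| <= D /\
    `|u ord0 ord_max - v ord0 ord_max| <= 2 * rho.
  move=> [[Au fu] [ux uy]] [[Av fv] [vx vy]].
  have tri (a b c : R) : `|a - c| <= rho -> `|b - c| <= rho -> `|a - b| <= 2 * rho.
    by rewrite !ler_norml; lra.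
  have dx := tri _ _ _ ux vx; have dy := tri _ _ _ uy vy; split=> //.
  have := Hrho _ _ Au Av; rewrite -fu -fv => H.
  rewrite /D ler_pdivlMr// mulrDr mulr1.
  suff : `|u ord0 ord0 - v ord0 ord0| * `|s| <= (2 + K0) * rho.
    by move=> ?; nra.
  rewrite mulrC -normrM; move: H dy; set p := s * _; rewrite !ler_norml; lra.
have [|nS] := pselect (S !=set0); last first.
  by apply: covers_empty nS; apply: mulr_ge0; [apply: mulr_ge0 => //|]; lra.
move=> [v Sv].
(* Oscillation of [f] over a column of width [r / 4], from the hypothesis at scale [r]. *)
pose h1 := (`|s| + L) * (r / 4) + K0 * r.
have h10 : 0 <= h1 by rewrite /h1; nra.
(* The first bound on the column height absorbs the slope when there are many
   columns, the second one when rounding leaves a single column. *)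
pose h := Num.min h1 (2 * rho).
have h0 : 0 <= h by rewrite /h le_min h10; lra.
have hh1 : h <= h1 by rewrite /h ge_min lexx.
have h2 : h <= 2 * rho by rewrite /h ge_min lexx orbT.
have q0 (a : R) : 0 <= a -> 0 <= a / r by move=> ?; rewrite divr_ge0// ltW.
apply: (@coversW _ _ S ((2 * D / (r / 4) + 1) * (8 * h / r + 1))) => //; last first.
  apply: (@covers_slices _ _ ord0 (v ord0 ord0 - D)); rewrite ?divr_gt0//.
  - lra.
  - by rewrite addr_ge0// q0//; lra.
  - move=> u Su; have [] := SD u v Su Sv; rewrite ler_norml; lra.
  - move=> t; apply: (@covers_column _ _ t) => //; first by move=> u [].
    move=> a b [Sa /= ta] [Sb /= tb].
    rewrite /h le_min; have [_ ->] := SD a b Sa Sb; rewrite andbT.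
    have [[Aa fa] _] := Sa; have [[Ab fb] _] := Sb.
    have := Hr _ _ Aa Ab; rewrite -fa -fb.
    have dw : `|a ord0 ord0 - b ord0 ord0| <= r / 4 by rewrite ler_norml; lra.
    move: dw; set d := a ord0 ord0 - _ => dw H.
    have sd : `|s * d| <= `|s| * (r / 4) by rewrite normrM ler_wpM2l.
    have Ld : L * `|d| <= L * (r / 4) by rewrite ler_wpM2l//; lra.
    rewrite /h1; move: H sd; set p := s * d; set q := L * `|d| in Ld *.
    by rewrite !ler_norml; lra.
have hr2 : h / r <= 2 * (rho / r) by rewrite mulrA ler_pM2r// invr_gt0.
have hr1 : h / r <= (`|s| + L) / 4 + K0.
  by rewrite ler_pdivrMr//; move: hh1; rewrite /h1; lra.
(* Since [L >= 1], the second factor is at most [(1 + |s|) * (5 + 8 * K0) * L], and [D] absorbs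
   [1 + |s|]. *)
have key : D / r * (8 * (h / r) + 1) <= (4 + K0) * (5 + 8 * K0) * L * (rho / r).
  apply: (@le_trans _ _ (D / r * ((1 + `|s|) * ((5 + 8 * K0) * L)))).
    rewrite ler_wpM2l ?q0//.
    have sL : 0 <= `|s| * (L - 1) by apply: mulr_ge0; lra.
    have KL : 0 <= K0 * (L - 1) by apply: mulr_ge0; lra.
    have KsL : 0 <= K0 * (`|s| * L) by rewrite !mulr_ge0//; lra.
    lra.
  rewrite (_ : D / r * _ = (D * (1 + `|s|)) / r * ((5 + 8 * K0) * L)); last by ring.
  by rewrite Ds le_eqVlt; apply/orP; left; apply/eqP; ring.
(* The rounding of the number of columns leaves [8 * (h / r) + 1] without a factor [D]; [hr2] bounds
   it by [17 * (rho / r)]. *)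
rewrite (_ : (2 * D / (r / 4) + 1) * (8 * h / r + 1) =
  8 * (D / r * (8 * (h / r) + 1)) + 8 * (h / r) + 1); last by field; lra.
apply: (@le_trans _ _ (8 * ((4 + K0) * (5 + 8 * K0) * L * (rho / r)) + 16 * (rho / r) + rho / r)).
  lra.
rewrite (_ : C * L * (rho / r) = 8 * ((4 + K0) * (5 + 8 * K0) * L * (rho / r)) + 17 * L * (rho / r)); last by rewrite /C; ring.
nra.
Qed.

End Covering.

(** * The distance to the nearest integer *)

Section DistInt.
Context {R : realType}.
Implicit Types (x y t u : R).

Lemma dist_int_has_lbound t : has_lbound [set `|t - m%:~R| | m in [set: int]].
Proof. by exists 0 => _ [m _ <-]. Qed.

Lemma dist_int_le t (m : int) : dist_int t <= `|t - m%:~R|.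
Proof. by apply: ge_inf; [exact: dist_int_has_lbound|exists m]. Qed.

Lemma le_dist_int t y : (forall m : int, y <= `|t - m%:~R|) -> y <= dist_int t.
Proof.
move=> H; apply: lb_le_inf; first by exists `|t - 0%:~R|; exists 0.
by move=> _ [m _ <-].
Qed.

Lemma dist_int_lip t u : `|dist_int t - dist_int u| <= `|t - u|.
Proof.
have H (x y : R) : dist_int x <= dist_int y + `|x - y|.
  rewrite -lerBlDr; apply: le_dist_int => m; rewrite lerBlDr.
  apply: le_trans (dist_int_le x m) _.
  by rewrite (_ : x - m%:~R = (y - m%:~R) + (x - y)) ?ler_normD//; ring.
have := H t u; have := H u t; rewrite (distrC u t) ler_norml; lra.
Qed.

Lemma dist_int_itv t : 0 <= dist_int t <= 1.
Proof.
apply/andP; split; first by apply: le_dist_int.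
apply: le_trans (dist_int_le t (Num.floor t)) _.
have := floor_le_tmp t; have := floorD1_gt t; rewrite intrD ler_norml; lra.
Qed.

(** The breakpoints are the half-integers [j / 2]; between two consecutive ones the slope is 1 for
    even [j] and -1 for odd [j]. *)
Lemma dist_int_affine (j : int) : exists a, forall t u,
  j%:~R <= 2 * t <= j%:~R + 1 -> j%:~R <= 2 * u <= j%:~R + 1 ->
  dist_int t - dist_int u = a * (t - u).
Proof.
have intcase (i m : int) : (m <= i) \/ (i + 1 <= m).
  by case: (lerP m i) => [|im]; [left|right; rewrite lezD1].
have low (i : int) t : i%:~R <= t <= i%:~R + 2^-1 -> dist_int t = t - i%:~R.
  move=> it; apply/eqP; rewrite eq_le; apply/andP; split.
    by apply: le_trans (dist_int_le t i) _; rewrite ger0_norm//; lra.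
  apply: le_dist_int => m; rewrite ler_normr; case: (intcase i m).
    by rewrite -(ler_int R) => mi; apply/orP; left; lra.
  by rewrite -(ler_int R) intrD => mi; apply/orP; right; lra.
have up (i : int) t : i%:~R + 2^-1 <= t <= i%:~R + 1 -> dist_int t = i%:~R + 1 - t.
  move=> it; apply/eqP; rewrite eq_le; apply/andP; split.
    by apply: le_trans (dist_int_le t (i + 1)) _; rewrite intrD ler0_norm//; lra.
  apply: le_dist_int => m; rewrite ler_normr; case: (intcase i m).
    by rewrite -(ler_int R) => mi; apply/orP; left; lra.
  by rewrite -(ler_int R) intrD => mi; apply/orP; right; lra.
have jE := divz_eq j 2; set i := (j %/ 2)%Z in jE.
have := modz_ge0 j (isT : (2 : int) != 0); have := ltz_pmod j (isT : (0 : int) < 2).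
move: jE; set e := (j %% 2)%Z => jE e2 e0.
have jR : j%:~R = 2 * i%:~R + e%:~R :> R by rewrite jE intrD intrM mulrC.
have [ee|ee] : e = 0 \/ e = 1 by lia.
  exists 1 => t u; rewrite jR ee mulr0z => ht hu.
  by rewrite !(low i) ?mul1r//; lra.
exists (-1) => t u; rewrite jR ee mulr1z => ht hu.
by rewrite !(up i) //; lra.
Qed.

End DistInt.

(** * Increments of the series: head, middle terms and tail *)

Section Takagi.
Context {R : realType}.
Variables (b : nat) (c : nat -> R) (K : R).
Hypothesis hb : (2 <= b)%N.
Hypothesis cK : forall n, b%:R ^+ n * `|c n| <= K.
Local Notation B := (b%:R : R).
Local Notation d x y n := (c n * (dist_int (B ^+ n * x) - dist_int (B ^+ n * y))).

Let B2 : 2 <= B. Proof. by rewrite ler_nat. Qed.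
Let B0 : 0 < B. Proof. by move: B2; lra. Qed.
Let Bn0 n : 0 < B ^+ n. Proof. exact: exprn_gt0. Qed.
Let K0 : 0 <= K. Proof. by apply: le_trans (cK 0); rewrite mulr_ge0// ltW. Qed.

Lemma coef_le n : `|c n| <= K / B ^+ n.
Proof. by rewrite ler_pdivlMr// mulrC. Qed.

Lemma takagi_cvg x : cvgn (series (fun n => c n * dist_int (B ^+ n * x))).
Proof.
apply: normed_cvg; apply: (@series_le_cvg _ _ (geometric K B^-1)) => //.
- by move=> n /=.
- by move=> n; rewrite /= mulr_ge0 ?K0// exprn_ge0// invr_ge0 ltW.
- move=> n; rewrite /= normrM exprVn; have /andP[p0 p1] := dist_int_itv (B ^+ n * x).
  rewrite (ger0_norm p0); apply: le_trans (coef_le n).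
  by rewrite -[leRHS]mulr1 ler_wpM2l.
- apply: is_cvg_geometric_series; rewrite ger0_norm ?invr_ge0 ?(ltW B0)//.
  by rewrite invf_lt1//; move: B2; lra.
Qed.

(** The Lipschitz constant [b^n] of the rescaled distance is compensated by the decay of [c n]. *)
Lemma term_lip x y n : `|d x y n| <= K * `|x - y|.
Proof.
rewrite normrM; have := dist_int_lip (B ^+ n * x) (B ^+ n * y).
rewrite -mulrBr normrM (ger0_norm (ltW (Bn0 n))) => H.
apply: le_trans (ler_wpM2l (normr_ge0 _) H) _.
by rewrite mulrA ler_wpM2r// mulrC.
Qed.

Lemma term_le x y n : `|d x y n| <= K / B ^+ n.
Proof.
rewrite normrM; apply: le_trans (coef_le n); rewrite -[leRHS]mulr1 ler_wpM2l//.
have := dist_int_itv (B ^+ n * x); have := dist_int_itv (B ^+ n * y).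
by rewrite ler_norml; lra.
Qed.

Lemma takagi_sub_cvg x y :
  (fun n => \sum_(i < n) d x y i) @ \oo --> takagi c b x - takagi c b y.
Proof.
have -> : (fun n => \sum_(i < n) d x y i) =
    series (fun n => c n * dist_int (B ^+ n * x)) -
    series (fun n => c n * dist_int (B ^+ n * y)).
  apply/funext => n; rewrite -[RHS]/(series _ n - series _ n) /series/= !big_mkord -sumrB.
  by apply: eq_bigr => i _; ring.
by apply: cvgB; exact: takagi_cvg.
Qed.

(** The free [q] sets the scale: [q = 0] is used at scale [rho], and [q] near [log_b (rho / r)] at
    scale [r]. *)
Lemma takagi_sub_le x y t m q :
  \sum_(i < m) d x y i = t ->
  `|takagi c b x - takagi c b y - t| <=
    K * q%:R * `|x - y| + 2 * K / B ^+ (m + q).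
Proof.
move=> mt.
have Hq : `|\sum_(i < m + q) d x y i - t| <= K * q%:R * `|x - y|.
  elim: q => [|q IH]; first by rewrite addn0 mt subrr normr0 mulr0 mul0r.
  rewrite addnS big_ord_recr /= -natr1 (mulrDr K) mulr1 (mulrDl _ K).
  rewrite addrAC; apply: le_trans (ler_normD _ _) _.
  by apply: lerD => //; exact: term_lip.
(* The subtracted term makes the induction telescope: as [b >= 2], replacing [p] by [b * p] lowers
   [2 * K / p] by at least [K / p], the size of the new term. *)
have Hj j : `|\sum_(i < m + q + j) d x y i - t| <= K * q%:R * `|x - y| +
    (2 * K / B ^+ (m + q) - 2 * K / B ^+ (m + q + j)).
  elim: j => [|j IH]; first by rewrite addn0 subrr addr0.
  rewrite addnS big_ord_recr /= addrAC; apply: le_trans (ler_normD _ _) _.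
  apply: le_trans (lerD IH (term_le _ _ _)) _.
  have B1 := B2; have B1' := B0; have Bp := Bn0 (m + q + j); have Kp := K0.
  rewrite exprS; set p := B ^+ (m + q + j) in Bp *.
  have : 2 * K / (B * p) <= K / p.
    by rewrite invfM mulrA ler_wpM2r ?invr_ge0 ?(ltW Bp)// ler_pdivrMr//; nra.
  have : 0 <= K / p by rewrite divr_ge0// ltW.
  rewrite -mulrA; lra.
set M := leRHS.
have Hb : \forall n \near \oo, `|\sum_(i < n) d x y i - t| <= M.
  near=> n; have mqn : (m + q <= n)%N by near: n; exact: nbhs_infty_ge.
  rewrite -(subnKC mqn); apply: le_trans (Hj _) _; rewrite /M lerD2l gerBl.
  by rewrite divr_ge0 ?(ltW (Bn0 _))// mulr_ge0.
have cv := takagi_sub_cvg x y.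
rewrite -(cvg_lim _ cv)// ler_norml lerBrDr lerBlDr; move/cvgP in cv.
apply/andP; split.
  apply: limr_ge => //; apply: filterS Hb => n; rewrite ler_norml; lra.
apply: limr_le => //; apply: filterS Hb => n; rewrite ler_norml; lra.
Unshelve. all: by end_near. Qed.

(** The grid of mesh [b^-m / 2] refines that of mesh [b^-n / 2] for [n < m], so no term of the head
    has a breakpoint inside a cell. *)
Lemma partial_sum_affine m (k : int) : exists s, forall x y,
  k%:~R <= 2 * B ^+ m * x <= k%:~R + 1 -> k%:~R <= 2 * B ^+ m * y <= k%:~R + 1 ->
  \sum_(n < m) d x y n = s * (x - y).
Proof.
suff H n : (n < m)%N -> exists s, forall x y,
  k%:~R <= 2 * B ^+ m * x <= k%:~R + 1 -> k%:~R <= 2 * B ^+ m * y <= k%:~R + 1 ->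
  d x y n = s * (x - y).
  (* The induction is on the number [p] of terms, with the cell at level [m] fixed. *)
  have : forall p, (p <= m)%N -> exists s, forall x y,
    k%:~R <= 2 * B ^+ m * x <= k%:~R + 1 -> k%:~R <= 2 * B ^+ m * y <= k%:~R + 1 ->
    \sum_(n < p) d x y n = s * (x - y).
    elim=> [_|p IH pm]; first by exists 0 => x y _ _; rewrite big_ord0 mul0r.
    have [s Hs] := IH (ltnW pm); have [s' Hs'] := H p pm.
    by exists (s + s') => x y hx hy; rewrite big_ord_recr /= Hs// Hs'// mulrDl.
  by apply.
(* A cell of level [n] consists of [g] cells of level [m]; cell [k] lies in cell [j], the floor of
   [k / g]. *)
move=> nm; pose g := (b ^ (m - n))%N; pose j := (k %/ g)%Z.
have g0 : (0 < g)%N by rewrite expn_gt0 (leq_trans _ hb).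
have gE : B ^+ m = B ^+ n * g%:R by rewrite natrX -exprD subnKC// ltnW.
have [a Ha] := dist_int_affine j (R := R); exists (c n * a * B ^+ n) => x y hx hy.
have mid z : k%:~R <= 2 * B ^+ m * z <= k%:~R + 1 ->
    j%:~R <= 2 * (B ^+ n * z) <= j%:~R + 1.
  have gR : 0 < g%:R :> R by rewrite ltr0n.
  rewrite gE (_ : 2 * (B ^+ n * g%:R) * z = (2 * (B ^+ n * z)) * g%:R); last by ring.
  set u := 2 * _ => hu.
  have kE : (j * g <= k) by rewrite lez_floor// -lt0n.
  have kE' : (k + 1 <= (j + 1) * g) by rewrite lezD1 ltz_ceil// ltz_nat.
  move: kE kE'; rewrite -2!(ler_int R) intrD !intrM intrD -!pmulrn => kE kE'.
  apply/andP; split; rewrite -(ler_pM2r gR); lra.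
by rewrite (Ha _ _ (mid _ hx) (mid _ hy)); ring.
Qed.

End Takagi.

Lemma int_offset (k j : int) (n : nat) : k <= j -> j < k + n%:Z ->
  exists2 i : nat, (i < n)%N & k + i%:Z = j.
Proof. by move=> kj jn; exists `|j - k|%N; lia. Qed.

Lemma natr_dist_lt1 (R : realType) (k l : nat) : `|k%:R - l%:R : R| < 1 -> k = l.
Proof.
rewrite -[k%:R]/(k%:Z%:~R) -[l%:R]/(l%:Z%:~R) -intrB -intr_norm -[ltRHS]/(1%:~R).
rewrite ltr_int; lia.
Qed.

(** * Covering the graph in a ball, at a scale adapted to the radius *)

Section Upper.
Context {R : realType}.
Variables (b : nat) (c : nat -> R) (K : R).
Hypothesis hb : (2 <= b)%N.
Hypothesis cK : forall n, b%:R ^+ n * `|c n| <= K.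
Local Notation B := (b%:R : R).
Local Notation d x y n := (c n * (dist_int (B ^+ n * x) - dist_int (B ^+ n * y))).

Let B2 : 2 <= B. Proof. by rewrite ler_nat. Qed.
Let B0 : 0 < B. Proof. by move: B2; lra. Qed.
Let Bn0 n : 0 < B ^+ n. Proof. exact: exprn_gt0. Qed.
Let K0 : 0 <= K. Proof. by apply: le_trans (cK 0); rewrite mulr_ge0// ltW. Qed.

Lemma exp_between (t : R) : 1 <= t -> exists q, B ^+ q <= t < B ^+ q.+1.
Proof.
move=> t1; have ex : exists n, t < B ^+ n.
  exists (Num.trunc t).+1; apply: lt_trans (truncnS_gt t) _.
  by rewrite -natrX ltr_nat ltn_expl.
case: (ex_minnP ex) => -[|q]; first by rewrite expr0 ltNge t1.
move=> tq qmin; exists q; rewrite tq andbT leNgt; apply/negP => /qmin.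
by rewrite ltnn.
Qed.

(* For rho >= 1 the scale is m = 0 and no decomposition is needed; otherwise
   five half b-adic intervals of length b^-m / 2 >= rho / 2 cover the ball. *)
Lemma good_scale (z rho : R) : 0 < rho -> exists m (A : nat -> set R),
  [/\ 1 / B ^+ m <= B * rho,
      forall x, `|x - z| <= rho -> exists2 i, (i < 5)%N & A i x &
      forall i, exists s, forall x y, A i x -> A i y ->
        \sum_(n < m) d x y n = s * (x - y)].
Proof.
move=> rho0; have [rho1|rho1] := leP 1 rho.
  exists 0%N, (fun=> setT); split.
  - by rewrite expr0 divr1; move: B2; nra.
  - by move=> x _; exists 0%N.
  - by move=> _; exists 0 => x y _ _; rewrite big_ord0 mul0r.
have [m /andP[m1 m2]] : exists q, B ^+ q <= rho^-1 < B ^+ q.+1.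
  by apply: exp_between; rewrite invf_ge1// ltW.
(* As [b^m * rho <= 1], the rescaled coordinate moves by at most 2 within the ball, so its floor
   moves by at most 2 either way: five values starting at [k]. *)
pose k := Num.floor (2 * B ^+ m * z) - 2.
exists m, (fun i => [set x | (k + i%:Z)%:~R <= 2 * B ^+ m * x <= (k + i%:Z)%:~R + 1]).
have mrho : B ^+ m * rho <= 1 by rewrite -ler_pdivlMr// div1r.
split.
- rewrite ler_pdivrMr// mulrAC -exprS -ler_pdivrMr// div1r; exact: ltW.
- move=> x xz.
  have H : `|2 * B ^+ m * x - 2 * B ^+ m * z| <= 2.
    rewrite -mulrBr normrM (ger0_norm (_ : 0 <= 2 * B ^+ m)) ?mulr_ge0 ?(ltW (Bn0 m))//.
    have : B ^+ m * `|x - z| <= B ^+ m * rho by rewrite ler_wpM2l// ltW.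
    lra.
  move: H; set u := 2 * B ^+ m * x; set v := 2 * B ^+ m * z in k *; rewrite ler_norml => H.
  have fu := floor_le_tmp u; have fu' := floorD1_gt u.
  have fv := floor_le_tmp v; have fv' := floorD1_gt v.
  rewrite !intrD in fu' fv'.
  have l1 : k <= Num.floor u.
    by rewrite floor_ge_int_tmp /k intrB; lra.
  have l2 : Num.floor u < k + 5.
    by rewrite -(ltr_int R) /k intrD intrB; lra.
  have [i i5 ki] := int_offset _ _ _ l1 l2; exists i => //; rewrite /= ki -/u; lra.
- by move=> i; exact: partial_sum_affine.
Qed.

Lemma local_cover (r rho : R) (z : 'rV[R]_2) : 0 < r -> r < rho ->
  exists2 q, B ^+ q <= B ^+ 2 * (rho / r) &
  covers r ([set v : 'rV[R]_2 | v ord0 ord_max = takagi c b (v ord0 ord0)] `&`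
            [set v : 'rV[R]_2 | `|v ord0 ord0 - z ord0 ord0| <= rho /\
                     `|v ord0 ord_max - z ord0 ord_max| <= rho])
    (5 * ((8 * (4 + 2 * K * B) * (5 + 8 * (2 * K * B)) + 17) *
          (K * q%:R + 1) * (rho / r))).
Proof.
move=> r0 rrho; have rho0 : 0 < rho by lra.
have rr : 1 <= rho / r by rewrite ler_pdivlMr// mul1r ltW.
have [m [A [Am Ax As]]] := good_scale (z ord0 ord0) _ rho0.
(* Together with [1 / b^m <= b * rho], the upper bound [b * (rho / r) < b^(q+1)] makes
   [b^-(m+q+1) <= r]; so [q.+1] middle terms suffice. *)
have [q /andP[q1 q2]] : exists q, B ^+ q <= B * (rho / r) < B ^+ q.+1.
  by apply: exp_between; move: B2; nra.
exists q.+1.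
  by rewrite exprS expr2 -mulrA ler_wpM2l// ltW.
set f := takagi c b; set L := K * _ + 1.
have L1 : 1 <= L by rewrite /L lerDr mulr_ge0.
have m_rho : 2 * K / B ^+ m <= 2 * K * B * rho.
  by rewrite -(mulrA _ B) -(div1r (B ^+ m)) ler_wpM2l ?mulr_ge0.
have KB0 : 0 <= 2 * K * B by rewrite !mulr_ge0// ltW.
have mq_r : 2 * K / B ^+ (m + q.+1) <= 2 * K * B * r.
  have : 1 / B ^+ (m + q.+1) <= r.
    rewrite exprD invfM mulrA ler_pdivrMr//; apply: le_trans Am _.
    by move: q2; rewrite mulrA ltr_pdivrMr// (mulrC r) => /ltW.
  rewrite div1r => H; rewrite -(mulrA _ B) ler_wpM2l ?mulr_ge0//.
  by apply: le_trans H _; rewrite ler_peMl ?(ltW r0)//; move: B2; lra.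
set G := _ `&` _.
pose S i := [set v : 'rV[R]_2 | A i (v ord0 ord0) /\ v ord0 ord_max = f (v ord0 ord0)]
  `&` [set v : 'rV[R]_2 | `|v ord0 ord0 - z ord0 ord0| <= rho /\
                     `|v ord0 ord_max - z ord0 ord_max| <= rho].
apply: (@coversW _ _ _ (\bigcup_(i in `I_5) S i) _ _ _ (lexx _)).
  by move=> v [vf [vx vy]]; have [i i5 Ai] := Ax _ vx; exists i.
apply: covers_bigcup => i _; have [s Hs] := As i.
apply: (covers_steep _ _ _ _ s) => // x y Ax' Ay.
  have := takagi_sub_le b c K hb cK _ _ _ _ 0 (Hs _ _ Ax' Ay).
  rewrite mulr0 mul0r add0r addn0 => H; exact: le_trans m_rho.
apply: le_trans (takagi_sub_le b c K hb cK _ _ _ _ q.+1 (Hs _ _ Ax' Ay)) _.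
by rewrite lerD// ler_wpM2r// /L lerDl.
Qed.

(** From [1 + x <= exp x] at [x = e * q * ln b]; this trades the logarithmic factor [q] for a small
    power of [rho / r]. *)
Lemma exponent_le_powR (q : nat) (e : R) : 0 < e ->
  q%:R <= (B ^+ q) `^ e / (e * ln B).
Proof.
move=> e0; have lnB : 0 < ln B by rewrite ln_gt0//; move: B2; lra.
rewrite ler_pdivlMr ?mulr_gt0// /powR gt_eqF// lnXn//.
apply: le_trans (expR_ge1Dx _); rewrite -(mulr_natl (ln B)).
rewrite (_ : q%:R * (e * ln B) = e * (q%:R * ln B)); last by ring.
by rewrite lerDr.
Qed.

Lemma graph_covering (e : R) : 0 < e -> exists2 C, 0 < C &
  forall (r rho : R) (x : 'rV[R]_2), 0 < r -> r < rho ->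
   (covering_number r (eucl_closed_ball x rho `&` graph01 (takagi c b)) <=
           (C * (rho / r) `^ (1 + e))%:E)%E.
Proof.
move=> e0; have lnB : 0 < ln B by rewrite ln_gt0//; move: B2; lra.
pose C0 := 8 * (4 + 2 * K * B) * (5 + 8 * (2 * K * B)) + 17.
have KB0 : 0 <= 2 * K * B by rewrite !mulr_ge0// ltW.
have C00 : 0 < C0 by rewrite /C0; nra.
(* Chosen so that [K * q + 1 <= D * (rho / r)^e], given [b^q <= b^2 * (rho / r)]. *)
pose D := K * ((B ^+ 2) `^ e / (e * ln B)) + 1.
have D0 : 0 < D.
  rewrite /D ltr_wpDl// mulr_ge0// divr_ge0 ?powR_ge0// mulr_ge0// ltW//.
exists (5 * (C0 * D)); first by rewrite !mulr_gt0.
move=> r rho x r0 rrho; have rho0 : 0 < rho by lra.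
have rr : 1 <= rho / r by rewrite ler_pdivlMr// mul1r ltW.
have [q q1 [n nX ncov]] := local_cover _ _ x r0 rrho.
have {}ncov : open_coverable r (eucl_closed_ball x rho `&` graph01 (takagi c b)) n.
  have [U [Uo GU]] := ncov; exists U; split=> //; apply: subset_trans GU => v [vx [t _ tv]].
  split; first by rewrite /= -tv !mxE.
  have D' k : `|v ord0 k - x ord0 k| <= rho.
    by apply: le_trans vx; rewrite distrC; exact: eucl_dist_coord.
  by split; exact: D'.
apply: ge_ereal_inf; exists (n%:R)%:E; first by exists n.
rewrite lee_fin; apply: le_trans nX _.
have p1 : 1 <= (rho / r) `^ e.
  have -> : 1 = 1 `^ e :> R by rewrite powR1.
  rewrite ge0_ler_powR// ?nnegrE ?(ltW e0)//; lra.
have qe : q%:R <= (B ^+ 2) `^ e / (e * ln B) * (rho / r) `^ e.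
  apply: le_trans (exponent_le_powR q _ e0) _.
  rewrite mulrAC ler_pM2r ?invr_gt0 ?mulr_gt0// -powRM ?(ltW (Bn0 _))//; last lra.
  by rewrite ge0_ler_powR ?(ltW e0)// nnegrE ?(ltW (Bn0 _))// mulr_ge0 ?(ltW (Bn0 _))//; lra.
have key : K * q%:R + 1 <= D * (rho / r) `^ e.
  by rewrite /D mulrDl mul1r lerD// -mulrA ler_wpM2l.
rewrite powRD; last by rewrite gt_eqF// addr_gt0.
rewrite powRr1 ?(le_trans ler01)// -/C0.
have : C0 * (K * q%:R + 1) * (rho / r) <= C0 * (D * (rho / r) `^ e) * (rho / r).
  by rewrite ler_wpM2r ?(le_trans ler01)// ler_pM2l.
move: (_ `^ e) => P; lra.
Qed.

(** * The lower bound by separated points *)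

Lemma graph_separated (n N : nat) (r : R) (S : set 'rV[R]_2) :
  r * n%:R < 1 -> open_coverable r S N ->
  (forall x : R, 0 <= x <= 1 -> exists2 v, S v & v ord0 ord0 = x) -> (n <= N)%N.
Proof.
move=> rn [U [Uo SU]] Sx.
(* Pigeonhole: points with abscissas [k / n] are at least [1 / n > r] apart, so a set of diameter at
   most [r] contains at most one of them. *)
have H (k : 'I_n) : exists i : 'I_N, exists2 v, U i v & v ord0 ord0 = k%:R / n%:R.
  have n0 : 0 < n%:R :> R by rewrite ltr0n (leq_ltn_trans (leq0n k)).
  have [|v Sv vx] := Sx (k%:R / n%:R).
    by rewrite divr_ge0//= ler_pdivrMr// mul1r ler_nat ltnW.
  by have [i _ Uv] := SU _ Sv; exists i, v.
have [g Hg] := choice H.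
suff ginj : injective g by have := leq_card g ginj; rewrite !card_ord.
move=> k l gkl; apply: val_inj.
have n0 : 0 < n%:R :> R by rewrite ltr0n (leq_ltn_trans (leq0n k)).
have [u Uu ux] := Hg k; have [v Uv vx] := Hg l; rewrite -gkl in Uv.
have uv : eucl_dist u v <= r.
  rewrite -lee_fin; apply: le_trans (Uo (g k)).2; apply: ereal_sup_ubound.
  by exists (u, v).
have := le_trans (eucl_dist_coord u v ord0) uv; rewrite ux vx -mulrBl normrM.
rewrite [X in _ * X]ger0_norm ?invr_ge0 ?(ltW n0)// ler_pdivrMr// => kl.
exact: natr_dist_lt1 (le_lt_trans kl rn).
Qed.

Lemma assouad_exponent_ge1 (al C : R) : 0 < al -> 0 < C ->
  (forall (r rho : R) (x : 'rV[R]_2), 0 < r -> r < rho ->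
     graph01 (takagi c b) x ->
     (covering_number r (eucl_closed_ball x rho `&` graph01 (takagi c b)) <=
           (C * (rho / r) `^ al)%:E)%E) -> 1 <= al.
Proof.
move=> al0 C0 H; rewrite leNgt; apply/negP => al1.
set f := takagi c b in H *.
pose P x : 'rV[R]_2 := \row_(i < 2) [:: x; f x]`_i.
have P0 x : P x ord0 ord0 = x by rewrite /P mxE.
have P1 x : P x ord0 ord_max = f x by rewrite /P mxE.
(* The ball of this radius around [P 0] contains the whole graph, since [|x| <= 1] and
   [|f 0 - f x| <= 2 * K]. *)
pose rho := 2 + 2 * K.
have rho2 : 2 <= rho by rewrite /rho lerDl mulr_ge0.
(* With [r = 1 / (2 * n)] the doubled covering bound equals [A * n^al]. The choice of [n] below
   gives [n^(1 - al) >= A], which contradicts [n < A * n^al]. *)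
pose A := 2 * C * (rho * 2) `^ al.
have A0 : 0 < A by rewrite !mulr_gt0// powR_gt0// mulr_gt0//; lra.
pose n := (Num.trunc (A `^ (1 - al)^-1)).+1.
have n0 : 0 < n%:R :> R by rewrite ltr0n.
have n1 : 1 <= n%:R :> R by rewrite ler1n.
pose r := (n%:R * 2)^-1 : R.
have r0 : 0 < r by rewrite invr_gt0 mulr_gt0.
have rrho : r < rho.
  by rewrite /r invf_plt ?posrE ?mulr_gt0//; try lra; rewrite (lt_le_trans (_ : rho^-1 < 1)) ?invf_lt1//; lra.
have X0 : 0 < C * (rho / r) `^ al by rewrite mulr_gt0// powR_gt0// divr_gt0//; lra.
have Pg x : 0 <= x <= 1 -> graph01 f (P x) by move=> x01; exists x; rewrite //= in_itv.
have := H r rho (P 0) r0 rrho (Pg 0 _); rewrite lexx ler01 => /(_ isT) Hc.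
(* Doubling makes the inequality strict, so that the infimum yields an actual finite cover. *)
have : (covering_number r (eucl_closed_ball (P 0%R) rho `&` graph01 f) <
   (2 * (C * (rho / r) `^ al))%:E)%E.
  by apply: le_lt_trans Hc _; rewrite lte_fin; lra.
move=> /ereal_inf_lt[_ [N Ncov <-]]; rewrite lte_fin => NX.
have nN : (n <= N)%N.
  apply: (graph_separated _ _ _ _ _ Ncov); first by rewrite /r invfM mulrAC mulVf ?gt_eqF// mul1r; lra.
  move=> x x01; exists (P x) => //; split; last exact: Pg.
  rewrite /eucl_closed_ball /= eucl_dist2 !P0 !P1.
  have := takagi_sub_le b c K hb cK 0 x 0 0 0.
  rewrite big_ord0 => /(_ erefl); rewrite mulr0 mul0r add0r expr0 divr1 subr0 -/f => Hf.
  rewrite -[leRHS]gtr0_norm -?sqrtr_sqr; last lra.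
  rewrite ler_sqrt ?sqr_ge0// -(real_normK (num_real (f 0 - f x))).
  move: Hf; set t := `|f 0 - f x|; have t0 : 0 <= t by rewrite normr_ge0.
  have Kp := K0; rewrite /rho => tK.
  rewrite !expr2; nra.
have {nN NX} : n%:R < A * n%:R `^ al.
  apply: le_lt_trans (_ : n%:R <= N%:R) _; first by rewrite ler_nat.
  apply: lt_le_trans NX _; rewrite /A /r invrK (mulrC n%:R) (mulrA rho) (powRM _ _ (ltW n0))//; last first.
    by lra.
  by rewrite !mulrA lexx.
have nE : n%:R = n%:R `^ (1 - al) * n%:R `^ al :> R.
  by rewrite -powRD ?subrK ?powRr1// ?oner_eq0.
rewrite [X in X < _]nE ltr_pM2r ?powR_gt0//; apply/negP; rewrite -leNgt.
have -> : A = (A `^ (1 - al)^-1) `^ (1 - al).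
  by rewrite -powRrM mulVf ?powRr1 ?(ltW A0)// subr_eq0 gt_eqF.
apply: ge0_ler_powR; rewrite ?nnegrE ?powR_ge0 ?subr_ge0 ?(ltW al1)//.
by apply: ltW; exact: truncnS_gt.
Qed.

End Upper.

(** * From the limsup hypothesis to a uniform bound, and the conclusion *)

Lemma limn_esup_bounded (R : realType) (u : nat -> R) :
  (limn_esup (EFin \o u) < +oo)%E -> exists K, forall n, u n <= K.
Proof.
move=> /ereal_inf_lt[_ [V [N _ NV] <-]] Vlt.
have [M VM] : exists M, forall n, (N <= n)%N -> u n <= M.
  move: Vlt; set s := ereal_sup _.
  have sub n : (N <= n)%N -> ((u n)%:E <= s)%E.
    by move=> Nn; apply: ereal_sup_ubound; exists n => //; exact: NV.
  (* A supremum equal to [-oo] is incompatible with [sub], so 0 is an arbitrary value there. *)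
  by case: s sub => [M|//|] sub _; [exists M => n /sub|exists 0 => n /sub].
exists (Num.max M (\big[Num.max/0]_(i < N) u i)) => n; rewrite le_max.
have [Nn|nN] := leqP N n; first by rewrite VM.
by apply/orP; right; exact: (le_bigmax _ (fun i : 'I_N => u i) (Ordinal nN)).
Qed.

Theorem theorem1p1 (R : realType) (b : nat) (hb : (2 <= b)%N) (c : nat -> R)
    (hc : (limn_esup (fun k => (b%:R ^+ k * `|c k|)%:E) < +oo)%E) :
  assouad_dim (graph01 (takagi c b)) = 1%:E.
Proof.
have [K cK] := limn_esup_bounded _ _ hc.
apply/eqP; rewrite eq_le; apply/andP; split.
  apply/lee_addgt0Pr => e e0; apply: ereal_inf_lbound; exists (1 + e) => //.
  split; first by rewrite addr_gt0.
  have [C C0 HC] := graph_covering _ _ _ hb cK _ e0.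
  by exists C => // r rho x r0 rrho _; exact: HC.
apply: le_ereal_inf_tmp => _ [al [al0 [C C0 HC]] <-]; rewrite lee_fin.
exact: (assouad_exponent_ge1 _ _ _ hb cK _ _ al0 C0 HC).
Qed.
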